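(* Let $H$ be a graph on $t$ vertices and let $r$ be fixed. (i) If $H$ has at least one dominating vertex, then $\operatorname{ex}(n,H,S_r) = (1-o(1))\, N\big(H, \lfloor n/r \rfloor K_r\big)$ as $n \to \infty$. (ii) If $H$ has at least two dominating vertices, then $\operatorname{mex}(m,H,S_r) = (1-o(1))\, N\big(H, \lfloor m/\binom{r}{2} \rfloor K_r\big)$ as $m \to \infty$.
   Context: For graphs $F,G$, $N(F,G)$ is the number of (not necessarily induced) subgraphs of $G$ isomorphic to $F$; $G$ is $F$-free if $N(F,G)=0$. $\operatorname{ex}(n,H,F) = \max\{N(H,G) : |V(G)| = n,\ G \text{ is } F\text{-free}\}$ and $\operatorname{mex}(m,H,F) = \max\{N(H,G) : |E(G)| = m,\ G \text{ is } F\text{-free}\}$. $S_r$ is the star with $r$ leaves, and $kK_r$ denotes the disjoint union of $k$ copies of the complete graph $K_r$. A dominating vertex is one adjacent to all other vertices. *)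

(* Defs.v *)
From HB Require Import structures.
From mathcomp Require Import all_boot all_order all_algebra.
From mathcomp Require Import all_classical all_reals all_analysis.
Import Order.TTheory GRing.Theory Num.Theory.
Import numFieldNormedType.Exports.

Set Implicit Arguments.
Unset Strict Implicit.
Unset Printing Implicit Defensive.

Local Open Scope nat_scope.

Record sgraph := SGraph {
  vertex :> finType;
  adj : rel vertex;
  adj_sym : symmetric adj;
  adj_irr : irreflexive adj }.

Definition edges (G : sgraph) : {set {set G}} :=
  [set e : {set G} | [exists x, exists y, adj x y && (e == [set x; y])]].

(* A pair (U, D) consists of a candidate vertex set and edge set. *)
Definition is_subgraph (G : sgraph) (S : {set G} * {set {set G}}) : bool :=
  (S.2 \subset edges G) && [forall e in S.2, e \subset S.1].

Definition iso_subgraph (F G : sgraph) (S : {set G} * {set {set G}}) : bool :=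
  [exists f : {ffun F -> G},
    [&& injectiveb f, f @: [set: F] == S.1 &
        [forall x, forall y, adj x y == ([set f x; f y] \in S.2)]]].

Definition N (F G : sgraph) : nat :=
  #|[set S : {set G} * {set {set G}} | is_subgraph S && iso_subgraph F S]|.

Definition free (F G : sgraph) : Prop := N F G = 0.

Definition is_max (A : set nat) (k : nat) : Prop :=
  A k /\ (forall j, A j -> j <= k).

(* The maxima are stated as relations, [is_ex n H F k] reading "ex(n,H,F) exists
   and equals k": the maximum over all graphs with m edges ranges over
   arbitrarily many vertices, and need not exist for arbitrary H and F. *)
Definition is_ex (n : nat) (H F : sgraph) (k : nat) : Prop :=
  is_max [set j | exists G : sgraph, [/\ #|G| = n, free F G & N H G = j]] k.

Definition is_mex (m : nat) (H F : sgraph) (k : nat) : Prop :=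
  is_max
    [set j | exists G : sgraph, [/\ #|edges G| = m, free F G & N H G = j]] k.

Definition dominating (G : sgraph) : {set G} :=
  [set v | [forall w, (w != v) ==> adj v w]].

(* The centre is [ord0], the leaves are the other r vertices. *)
Definition star_adj (r : nat) : rel 'I_r.+1 :=
  fun x y => (x == ord0) != (y == ord0).

Lemma star_adj_sym r : symmetric (@star_adj r).
Proof. by move=> x y; rewrite /star_adj eq_sym. Qed.

Lemma star_adj_irr r : irreflexive (@star_adj r).
Proof. by move=> x; rewrite /star_adj eqxx. Qed.

Definition star (r : nat) : sgraph := SGraph (@star_adj_sym r) (@star_adj_irr r).

Definition complete_adj (r : nat) : rel 'I_r := fun x y => x != y.

Lemma complete_adj_sym r : symmetric (@complete_adj r).
Proof. by move=> x y; rewrite /complete_adj eq_sym. Qed.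

Lemma complete_adj_irr r : irreflexive (@complete_adj r).
Proof. by move=> x; rewrite /complete_adj eqxx. Qed.

Definition complete (r : nat) : sgraph :=
  SGraph (@complete_adj_sym r) (@complete_adj_irr r).

Definition copies_adj (k : nat) (G : sgraph) : rel ('I_k * G)%type :=
  fun x y => (x.1 == y.1) && adj x.2 y.2.

Lemma copies_adj_sym k G : symmetric (@copies_adj k G).
Proof. by move=> x y; rewrite /copies_adj eq_sym adj_sym. Qed.

Lemma copies_adj_irr k G : irreflexive (@copies_adj k G).
Proof. by move=> x; rewrite /copies_adj adj_irr andbF. Qed.

(* Disjoint union of k copies of G. *)
Definition copies (k : nat) (G : sgraph) : sgraph :=
  SGraph (@copies_adj_sym k G) (@copies_adj_irr k G).

(* Main.v *)
(**
  An [S_r]-free graph is a graph of maximum degree less than [r].  Counting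
  copies of [H] amounts, up to the factor [|Aut H|], to counting injective
  homomorphisms.  Once the image [x] of a dominating vertex is fixed, the other
  [t - 1] vertices of [H] inject into the neighborhood of [x], so there are at
  most [n (r-1)(r-2)...(r-t+1)] homomorphisms, which is [n/r] times their number
  into [K_r].  With two dominating vertices one fixes the image [(x, y)] of both,
  an arc of [G], and gets at most [2m (r-2)...(r-t+1)], i.e. [m / C(r,2)] times
  the number for [K_r].  Disjoint copies of [K_r], completed by isolated vertices
  or by a matching, attain these bounds up to a factor
  [1 + 1/floor(n/r)], resp. [1 + 1/floor(m/C(r,2))].
*)
Require Import Defs.
From HB Require Import structures.
From mathcomp Require Import all_boot all_order all_algebra.
From mathcomp Require Import all_classical all_reals all_analysis.
Import Order.TTheory GRing.Theory Num.Theory.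
Import numFieldNormedType.Exports.

(* [classical_sets] shadows the names of many lemmas on finite sets. *)
Import boot.fintype boot.finset.

Local Open Scope nat_scope.

(** * Edges as two-element sets *)

Lemma mem_edges (G : sgraph) (x y : G) : ([set x; y] \in edges G) = adj x y.
Proof.
rewrite inE; apply/existsP/idP => [[a /existsP[b /andP[ab /eqP e]]]|xy]; last first.
  by exists x; apply/existsP; exists y; rewrite xy eqxx.
have := set21 x y; rewrite e !inE => xab.
have := set22 x y; rewrite e !inE => yab.
have := set21 a b; rewrite -e !inE => axy.
have := set22 a b; rewrite -e !inE => bxy.
case/orP: xab => /eqP xE; case/orP: yab => /eqP yE; rewrite xE yE in axy bxy *.
- by move: bxy ab; rewrite orbb => /eqP ->.
- by [].
- by rewrite adj_sym.
- by move: axy ab; rewrite orbb => /eqP ->.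
Qed.

Lemma edgesP {G : sgraph} {e : {set G}} :
  reflect (exists x y, adj x y /\ e = [set x; y]) (e \in edges G).
Proof.
rewrite inE; apply: (iffP existsP) => [[a /existsP[b /andP[ab /eqP e_ab]]]|].
  by exists a, b.
by move=> [a [b [ab ->]]]; exists a; apply/existsP; exists b; rewrite ab eqxx.
Qed.

Lemma imset_set2 {aT rT : finType} (f : aT -> rT) (x y : aT) :
  f @: [set x; y] = [set f x; f y].
Proof. by rewrite imsetU !imset_set1. Qed.

(** * Injective homomorphisms and copies of [H] *)

Definition embeddings (H G : sgraph) : {set {ffun H -> G}} :=
  [set f : {ffun H -> G} |
    injectiveb f && [forall x, forall y, adj x y ==> adj (f x) (f y)]].

Lemma embeddingsP {H G : sgraph} {f : {ffun H -> G}} :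
  reflect (injective f /\ forall x y, adj x y -> adj (f x) (f y))
          (f \in embeddings H G).
Proof.
rewrite inE; apply: (iffP andP) => -[/injectiveP f_inj f_hom]; split=> //.
  by move=> x y; move: f_hom => /forallP/(_ x)/forallP/(_ y)/implyP.
by apply/forallP => x; apply/forallP => y; apply/implyP/f_hom.
Qed.

Definition image_subgraph {H G : sgraph} (f : {ffun H -> G}) :
  {set G} * {set {set G}} := (f @: [set: H], [set f @: (e : {set H}) | e in edges H]).

Lemma mem_image_edges {H G : sgraph} (f : {ffun H -> G}) (x y : H) :
  injective f -> ([set f x; f y] \in (image_subgraph f).2) = adj x y.
Proof.
by move=> f_inj; rewrite -imset_set2 mem_imset ?mem_edges //; exact: imset_inj.
Qed.

Lemma image_subgraph_sub {H G : sgraph} (f : {ffun H -> G}) :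
  f \in embeddings H G -> is_subgraph (image_subgraph f).
Proof.
move=> /embeddingsP[_ f_hom]; apply/andP; split.
  apply/subsetP => _ /imsetP[_ /edgesP[x [y [xy ->]]] ->].
  by rewrite imset_set2 mem_edges f_hom.
by apply/forall_inP => _ /imsetP[e _ ->]; rewrite imsetS ?subsetT.
Qed.

(** A bijection witnessing that [(U, D)] is a copy of [H] is itself an embedding, because [D] lies
    in [edges G]. It recovers all of [D], since the edges in [D] have their endpoints in [U]. *)
Lemma N_image (H G : sgraph) : N H G = #|image_subgraph @: embeddings H G|.
Proof.
congr #|pred_of_set _|; apply/setP => -[U D]; rewrite !inE.
apply/andP/imsetP => [[/andP[/= /subsetP DG /forall_inP DU]]|[f f_emb ->]].
  move=> /existsP[f /and3P[/injectiveP f_inj /eqP/= fU /forallP fD]].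
  have adjD x y : adj x y = ([set f x; f y] \in D).
    by apply/eqP; move: (fD x) => /forallP.
  exists f.
    by apply/embeddingsP; split=> // x y; rewrite adjD => /DG; rewrite mem_edges.
  rewrite /image_subgraph -fU; congr pair; apply/setP => e; apply/idP/imsetP.
    move=> eD; have /edgesP[a [b [_ eab]]] := DG _ eD.
    move: eD (DU _ eD); rewrite {}eab subUset !sub1set -fU.
    move=> abD /andP[/imsetP[x _ aE] /imsetP[y _ bE]].
    rewrite aE bE in abD *.
    by exists [set x; y]; rewrite ?imset_set2 // mem_edges adjD.
  by move=> [_ /edgesP[x [y [xy ->]]] ->]; rewrite imset_set2 -adjD.
split; first exact: image_subgraph_sub.
have /embeddingsP[f_inj _] := f_emb.
apply/existsP; exists f; rewrite eqxx; apply/andP; split; first exact/injectiveP.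
by apply/forallP => x; apply/forallP => y; rewrite mem_image_edges.
Qed.

(** By finiteness, an injective edge-preserving self-map permutes both vertices and edges. So
    [embeddings H H] is the automorphism group of [H]. *)
Lemma embedding_edges {H : sgraph} (s : {ffun H -> H}) :
  s \in embeddings H H -> image_subgraph s = ([set: H], edges H).
Proof.
move=> s_emb; have /embeddingsP[s_inj _] := s_emb; congr pair; apply/eqP.
  by rewrite eqEcard subsetT card_imset ?leqnn.
have /andP[sH _] := image_subgraph_sub _ s_emb.
by rewrite eqEcard sH card_imset ?leqnn //; exact: imset_inj.
Qed.

(** The embeddings with the same image as [f0] are exactly the composites of [f0] with an
    automorphism of [H]. *)
Lemma card_embedding_fiber {H G : sgraph} (f0 : {ffun H -> G}) :
  f0 \in embeddings H G ->
  #|[set f in embeddings H G | image_subgraph f == image_subgraph f0]| =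
  #|embeddings H H|.
Proof.
move=> f0_emb; have /embeddingsP[f0_inj f0_hom] := f0_emb.
pose comp (s : {ffun H -> H}) : {ffun H -> G} := [ffun x => f0 (s x)].
have comp_inj : injective comp.
  by move=> s s' /ffunP ss'; apply/ffunP => x; apply: f0_inj; have := ss' x; rewrite !ffunE.
rewrite -(card_imset _ comp_inj); congr #|pred_of_set _|; apply/setP => f.
rewrite inE; apply/andP/imsetP => [[/embeddingsP[f_inj f_hom] /eqP f_f0]|].
  have ex_s x : exists y, f0 y == f x.
    have : f x \in (image_subgraph f).1 by rewrite imset_f.
    by rewrite f_f0 => /imsetP[y _ ->]; exists y.
  (* This is the inverse of [f0] on the common image, composed with [f]. *)
  pose s := [ffun x => xchoose (ex_s x)].
  have f0s x : f0 (s x) = f x by rewrite ffunE; apply/eqP; exact: (xchooseP (ex_s x)).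
  exists s; last by apply/ffunP => x; rewrite ffunE.
  apply/embeddingsP; split=> [x y sxy|x y xy].
    by apply: f_inj; rewrite -!f0s sxy.
  by rewrite -(mem_image_edges f0) // !f0s -f_f0 mem_image_edges.
move=> [s s_emb ->]; have /embeddingsP[s_inj s_hom] := s_emb; split.
  by apply/embeddingsP; split=> [x y|x y xy]; rewrite !ffunE; [move/f0_inj/s_inj | exact: f0_hom _ _ (s_hom _ _ xy)].
have [sT sE] := embedding_edges _ s_emb.
have compE (A : {set H}) : comp s @: A = f0 @: (s @: A).
  by rewrite -imset_comp; apply: eq_imset => x; rewrite ffunE.
apply/eqP; congr pair; first by rewrite compE sT.
rewrite -[in RHS]sE -[in RHS]imset_comp.
by apply: eq_imset => A; rewrite compE.
Qed.

(** All fibers of [image_subgraph] have size |Aut H|. Inequalities between values of [N H] can thus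
    be proved for embeddings and this positive factor cancelled. *)
Lemma card_embeddings (H G : sgraph) :
  #|embeddings H G| = N H G * #|embeddings H H|.
Proof.
rewrite N_image -sum1_card.
rewrite (partition_big_imset image_subgraph) /= -sum_nat_const.
apply: eq_bigr => _ /imsetP[f0 f0_emb ->].
by rewrite -(card_embedding_fiber f0) // -sum1_card; apply: eq_bigl => f; rewrite inE.
Qed.

Lemma card_embeddings_gt0 (H : sgraph) : 0 < #|embeddings H H|.
Proof.
apply/card_gt0P; exists [ffun x => x].
by apply/embeddingsP; split=> x y; rewrite !ffunE.
Qed.

Lemma leq_card_embeddings (H G G' : sgraph) (g : G -> G') : injective g ->
  (forall x y, adj x y -> adj (g x) (g y)) ->
  #|embeddings H G| <= #|embeddings H G'|.
Proof.
move=> g_inj g_hom; pose h (f : {ffun H -> G}) : {ffun H -> G'} := [ffun x => g (f x)].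
have h_inj : injective h.
  by move=> f f' /ffunP ff'; apply/ffunP => x; apply: g_inj; have := ff' x; rewrite !ffunE.
rewrite -(card_imset _ h_inj); apply/subset_leq_card/subsetP.
move=> _ /imsetP[f /embeddingsP[f_inj f_hom] ->]; apply/embeddingsP.
by split=> [x y|x y xy]; rewrite !ffunE; [move/g_inj/f_inj | exact: g_hom _ _ (f_hom _ _ xy)].
Qed.

Lemma leq_N (H G G' : sgraph) (g : G -> G') : injective g ->
  (forall x y, adj x y -> adj (g x) (g y)) -> N H G <= N H G'.
Proof.
move=> g_inj /(leq_card_embeddings H _ _ _ g_inj).
by rewrite (card_embeddings H G) (card_embeddings H G') leq_pmul2r ?card_embeddings_gt0.
Qed.

Lemma card_embeddings_complete (H : sgraph) (r : nat) :
  #|embeddings H (complete r)| = r ^_ #|H|.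
Proof.
rewrite -[in RHS](card_ord r) -card_inj_ffuns; apply: eq_card => f.
rewrite !inE; apply/andP/idP => [[]//|/injectiveP f_inj].
split; first exact/injectiveP.
apply/forallP => x; apply/forallP => y; apply/implyP => xy.
by rewrite /= /complete_adj inj_eq //; apply: contraTneq xy => ->; rewrite adj_irr.
Qed.

(** Each embedding into [G] is placed in any one of the [k] copies. A vertex of [H] lets the index
    of the copy be read off from the resulting map. *)
Lemma leq_N_copies (H G : sgraph) (k : nat) :
  0 < #|H| -> k * N H G <= N H (copies k G).
Proof.
move=> /card_gt0P[v _].
rewrite -(leq_pmul2r (card_embeddings_gt0 H)) -mulnA -!card_embeddings.
pose h (p : 'I_k * {ffun H -> G}) : {ffun H -> copies k G} := [ffun x => (p.1, p.2 x)].
have h_inj : injective h.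
  move=> [i f] [j f'] /ffunP ff'; congr pair.
    by have := ff' v; rewrite !ffunE => -[].
  by apply/ffunP => x; have := ff' x; rewrite !ffunE => -[].
rewrite -[X in X * _]card_ord -cardsT -cardsX -(card_imset _ h_inj).
apply/subset_leq_card/subsetP => _ /imsetP[[i f] /setXP[_ /embeddingsP[f_inj f_hom]] ->].
apply/embeddingsP; split=> [x y|x y xy]; rewrite !ffunE; first by case=> /f_inj.
by rewrite /= /copies_adj /= eqxx f_hom.
Qed.

(** * Star-freeness as a degree bound, and degree sums *)

Definition neighbors {G : sgraph} (x : G) : {set G} := [set y | adj x y].

Lemma free_starP (r : nat) (G : sgraph) :
  Defs.free (star r) G <-> forall x : G, #|neighbors x| < r.
Proof.
have -> : Defs.free (star r) G <-> #|embeddings (star r) G| = 0.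
  rewrite /Defs.free card_embeddings; split=> [->//|/eqP].
  by rewrite muln_eq0 [X in _ || X]eqn0Ngt card_embeddings_gt0 orbF => /eqP.
split=> [/eqP + x|deg_lt]; last first.
  apply/eqP; rewrite cards_eq0; apply: contraT => /set0Pn[f /embeddingsP[f_inj f_hom]].
  have := deg_lt (f ord0); rewrite ltnNge => /negP[].
  have g_inj : injective (fun i : 'I_r => f (lift ord0 i)).
    by move=> i j /f_inj /lift_inj.
  rewrite -[X in X <= _]card_ord -cardsT -(card_imset _ g_inj).
  apply/subset_leq_card/subsetP => _ /imsetP[i _ ->].
  by rewrite inE f_hom.
apply: contraTT; rewrite -leqNgt => deg_ge; rewrite -lt0n; apply/card_gt0P.
have nbr (i : 'I_r) : i < size (enum (neighbors x)).
  by rewrite -cardE (leq_trans (ltn_ord i)).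
(* The centre goes to [x] and the leaves to the first [r] neighbors in their enumeration. By [nbr]
   the default value of [nth] is never reached. *)
pose f : {ffun star r -> G} :=
  [ffun i : 'I_r.+1 => if unlift ord0 i is Some j then nth x (enum (neighbors x)) j else x].
have f_nbr (j : 'I_r) : adj x (nth x (enum (neighbors x)) j).
  by have := mem_nth x (nbr j); rewrite mem_enum inE.
exists f; apply/embeddingsP; split=> i j; rewrite !ffunE.
  case: unliftP => [i' ->|->]; case: unliftP => [j' ->|->] //.
  - by move/eqP; rewrite nth_uniq ?enum_uniq // => /eqP/val_inj->.
  - by move=> e; have := f_nbr i'; rewrite e adj_irr.
  - by move=> e; have := f_nbr j'; rewrite -e adj_irr.
rewrite /adj /= /star_adj.
case: unliftP => [i' ->|->]; case: unliftP => [j' ->|->] // _.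
by have := f_nbr i'; rewrite adj_sym.
Qed.

(** Each edge [[set a; b]] carries the two distinct arcs [(a, b)] and [(b, a)]. *)
Lemma card_arcs (G : sgraph) : \sum_(p : G * G | adj p.1 p.2) 1 = 2 * #|edges G|.
Proof.
rewrite (partition_big (fun p : G * G => [set p.1; p.2]) (mem (edges G))) /=; last first.
  by move=> p; rewrite mem_edges.
rewrite mulnC -sum_nat_const; apply: eq_bigr => _ /edgesP[a [b [ab ->]]].
have neq_ab : a != b by apply: contraTneq ab => ->; rewrite adj_irr.
have -> : 2 = #|[set (a, b); (b, a)]|.
  by rewrite cards2 xpair_eqE negb_and neq_ab.
rewrite -sum1_card; apply: eq_bigl => -[x y]; rewrite !inE /= !xpair_eqE.
apply/andP/orP => [[xy /eqP e]|[]/andP[/eqP-> /eqP->]]; last 2 first.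
- by split.
- by rewrite adj_sym setUC; split.
have neq_xy : x != y by apply: contraTneq xy => ->; rewrite adj_irr.
have := set21 x y; rewrite e !inE => xab.
have := set22 x y; rewrite e !inE => yab.
move: neq_xy; case/orP: xab => /eqP ->; case/orP: yab => /eqP ->; rewrite ?eqxx //.
  by left.
by right.
Qed.

Lemma sum_card_neighbors (G : sgraph) :
  \sum_(x : G) #|neighbors x| = 2 * #|edges G|.
Proof.
rewrite -card_arcs -(pair_big_dep xpredT (fun x y : G => adj x y) (fun _ _ => 1)) /=.
by apply: eq_bigr => x _; rewrite -sum1_card; apply: eq_bigl => y; rewrite inE.
Qed.

(** * Upper bounds from dominating vertices *)

Lemma card_inj_ffuns_fixed {aT rT : finType} (g : aT -> rT) (A : {set aT}) (D : {set rT}) :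
  #|[set f : {ffun aT -> rT} | [&& injectiveb f, [forall x in A, f x == g x]
     & [forall x in ~: A, f x \in D]]]| <= #|D| ^_ #|~: A|.
Proof.
pose S : finType := {x : aT | x \in ~: A}.
have -> : #|~: A| = #|S| by rewrite card_sig; apply: eq_card => x; rewrite !inE.
rewrite -card_inj_ffuns_on.
(* On [A] the maps counted agree with [g], so each is determined by its restriction to the
   complement, an injection into [D]. *)
pose res (f : {ffun aT -> rT}) : {ffun S -> rT} := [ffun x => f (val x)].
set F := [set f : {ffun aT -> rT} | _].
have res_inj : {in F &, injective res}.
  move=> f f'; rewrite !inE => /and3P[_ /forall_inP fA _] /and3P[_ /forall_inP f'A _].
  move=> /ffunP res_eq; apply/ffunP => x; case: (boolP (x \in ~: A)) => xA.
    by have := res_eq (exist _ x xA); rewrite !ffunE.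
  by rewrite inE negbK in xA; rewrite (eqP (fA _ xA)) (eqP (f'A _ xA)).
rewrite -(card_in_imset res_inj); apply/subset_leq_card/subsetP.
move=> _ /imsetP[f + ->]; rewrite !inE => /and3P[/injectiveP f_inj _ /forall_inP fD].
apply/andP; split; first by apply/ffun_onP => x; rewrite ffunE; exact/fD/valP.
by apply/injectiveP => x y; rewrite !ffunE => /f_inj/val_inj.
Qed.

Lemma leq_ffact2l (m n k : nat) : m <= n -> m ^_ k <= n ^_ k.
Proof. by move=> mn; rewrite !ffact_prod; apply: leq_prod => i _; rewrite leq_sub2r. Qed.

Lemma dominating_adj {H : sgraph} (v w : H) :
  v \in dominating H -> w != v -> adj v w.
Proof. by rewrite inE => /forallP/(_ w)/implyP. Qed.

(** Embeddings are grouped by the image [x] of a dominating vertex. The shift in [star r.+1] makes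
    the degree bound exactly [r]. *)
Lemma leq_embeddings_vertices (H G : sgraph) (r : nat) : 0 < #|dominating H| ->
  Defs.free (star r.+1) G -> #|embeddings H G| <= #|G| * r ^_ #|H|.-1.
Proof.
move=> /card_gt0P[v v_dom] /free_starP deg_lt.
rewrite -sum1_card (partition_big (fun f : {ffun H -> G} => f v) predT) //=.
rewrite -sum_nat_const; apply: leq_sum => x _.
have cardC : #|~: [set v]| = #|H|.-1 by rewrite cardsC1.
apply: (leq_trans _ (leq_ffact2l #|neighbors x| r _ (deg_lt x))).
rewrite -cardC; apply: (leq_trans _ (card_inj_ffuns_fixed (fun=> x) [set v] (neighbors x))).
rewrite sum1_card; apply/subset_leq_card/subsetP => f /andP[/embeddingsP[f_inj f_hom] /eqP fv].
rewrite inE; apply/and3P; split; first exact/injectiveP.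
  by apply/forall_inP => y; rewrite inE => /eqP->; rewrite fv.
by apply/forall_inP => y; rewrite !inE => yv; rewrite -fv f_hom ?dominating_adj.
Qed.

(** Embeddings are grouped by the arc [(x, y)] onto which two dominating vertices go. Degrees are at
    most [r.+1], and removing [y] from the neighbors of [x] leaves at most [r] places for the other
    vertices. *)
Lemma leq_embeddings_edges (H G : sgraph) (r : nat) : 2 <= #|dominating H| ->
  Defs.free (star r.+2) G ->
  #|embeddings H G| <= (2 * #|edges G|) * r ^_ #|H|.-2.
Proof.
move=> /card_gt1P[u [v [u_dom v_dom uv]]] /free_starP deg_lt.
rewrite -card_arcs.
have vu : v != u by rewrite eq_sym.
rewrite -sum1_card (partition_big (fun f : {ffun H -> G} => (f u, f v))
  (fun p => adj p.1 p.2)) /=; last first.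
  by move=> f /embeddingsP[_ f_hom]; rewrite f_hom ?dominating_adj.
rewrite sum1_card -sum_nat_const; apply: leq_sum => -[x y] /= xy.
have cardC : #|~: [set u; v]| = #|H|.-2 by rewrite cardsCs setCK cards2 uv subn2.
have card_nbr : #|neighbors x :\ y| <= r.
  by have := deg_lt x; rewrite (cardsD1 y) inE xy.
apply: (leq_trans _ (leq_ffact2l _ _ _ card_nbr)).
rewrite -cardC; apply: (leq_trans _ (card_inj_ffuns_fixed
  (fun z => if z == u then x else y) [set u; v] (neighbors x :\ y))).
rewrite sum1_card; apply/subset_leq_card/subsetP.
move=> f /andP[/embeddingsP[f_inj f_hom] /eqP[fu fv]].
rewrite inE; apply/and3P; split; first exact/injectiveP.
  apply/forall_inP => z; rewrite !inE => /orP[]/eqP->; rewrite ?eqxx ?fu //.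
  by rewrite (negPf vu) fv.
apply/forall_inP => z; rewrite !inE negb_or => /andP[zu zv].
by rewrite -fu -fv inj_eq // zv f_hom ?dominating_adj.
Qed.
Lemma leq_N_vertices (H G : sgraph) (r : nat) : 0 < r -> 0 < #|dominating H| ->
  Defs.free (star r) G -> r * N H G <= #|G| * N H (complete r).
Proof.
case: r => // r _ dom_gt0 /(leq_embeddings_vertices H G r dom_gt0) le_emb.
have H_gt0 : 0 < #|H| := leq_trans dom_gt0 (max_card _).
rewrite -(leq_pmul2r (card_embeddings_gt0 H)) -!mulnA -!card_embeddings.
(* The falling factorial splits off the factor [r.+1], which turns the vertex bound into a count for
   the complete graph. *)
rewrite card_embeddings_complete -(prednK H_gt0) ffactSS mulnCA.
by rewrite leq_pmul2l.
Qed.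

Lemma leq_N_edges (H G : sgraph) (r : nat) : 1 < r -> 1 < #|dominating H| ->
  Defs.free (star r) G -> 'C(r, 2) * N H G <= #|edges G| * N H (complete r).
Proof.
case: r => [|[|r]] // _ dom_gt1 /(leq_embeddings_edges H G r dom_gt1) le_emb.
have H_gt1 : 1 < #|H| := leq_trans dom_gt1 (max_card _).
have H_ge2 : #|H|.-2.+2 = #|H| by case: #|H| H_gt1 => [|[|]].
rewrite -(leq_pmul2r (card_embeddings_gt0 H)) -!mulnA -!card_embeddings.
rewrite card_embeddings_complete -H_ge2 2!ffactSS.
(* Doubling turns the binomial coefficient into [r.+2 * r.+1], the two factors split off from the
   falling factorial, and supplies the 2 that counts arcs. *)
rewrite -(@leq_pmul2l 2) // mulnA -[2 * 'C(_, _)]mulnC (bin_ffact _ 2) !ffactnS ffactn0 muln1.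
rewrite (mulnCA _ #|edges G|) mulnCA (mulnCA _ r.+2) (mulnCA _ r.+1) -!mulnA.
by rewrite (mulnCA 2) (mulnCA 2) !leq_pmul2l // mulnA.
Qed.

(** * Disjoint unions of cliques as extremal constructions *)

Definition cluster_adj {T K : finType} (f : T -> K) : rel T := fun x y => (x != y) && (f x == f y).

Lemma cluster_adj_sym {T K : finType} (f : T -> K) : symmetric (cluster_adj f).
Proof. by move=> x y; rewrite /cluster_adj eq_sym [f x == _]eq_sym. Qed.

Lemma cluster_adj_irr {T K : finType} (f : T -> K) : irreflexive (cluster_adj f).
Proof. by move=> x; rewrite /cluster_adj eqxx. Qed.

Definition cluster {T K : finType} (f : T -> K) : sgraph :=
  SGraph (cluster_adj_sym f) (cluster_adj_irr f).

Lemma card_neighbors_cluster {T K : finType} (f : T -> K) (x : cluster f) :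
  #|neighbors x| = #|[set y | f y == f x]|.-1.
Proof.
rewrite [in RHS](cardsD1 x) inE eqxx; congr #|pred_of_set _|; apply/setP => y.
by rewrite !inE /adj /= /cluster_adj eq_sym [f x == _]eq_sym.
Qed.

(** The disjoint union of [q] copies of K_r and [s] copies of K_c. One definition serves both
    constructions: [c = 1] adds isolated vertices, [c = 2] adds a matching. *)
Definition two_cliques (q r s c : nat) : sgraph :=
  cluster (fun x : ('I_q * 'I_r + 'I_s * 'I_c)%type =>
    match x return ('I_q + 'I_s)%type with inl p => inl p.1 | inr p => inr p.1 end).

Lemma card_two_cliques (q r s c : nat) : #|two_cliques q r s c| = q * r + s * c.
Proof. by rewrite card_sum !card_prod !card_ord. Qed.

Lemma card_neighbors_two_cliques (q r s c : nat) (x : two_cliques q r s c) :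
  #|neighbors x| = (match x with inl _ => r | inr _ => c end).-1.
Proof.
rewrite card_neighbors_cluster; congr _.-1; case: x => -[i j] /=.
  have inl_inj : injective (fun j' : 'I_r => @inl _ ('I_s * 'I_c) (i, j')).
    by move=> j1 j2 [].
  rewrite -[RHS]card_ord -cardsT -(card_imset _ inl_inj).
  congr #|pred_of_set _|; apply/setP => -[[i' j']|[i' j']]; rewrite !inE.
    apply/eqP/imsetP => [[->]|[k _ [-> _]]//]; by exists j'.
  by apply/esym/negbTE/imsetP => -[].
have inr_inj : injective (fun j' : 'I_c => @inr ('I_q * 'I_r) _ (i, j')).
  by move=> j1 j2 [].
rewrite -[RHS]card_ord -cardsT -(card_imset _ inr_inj).
congr #|pred_of_set _|; apply/setP => -[[i' j']|[i' j']]; rewrite !inE.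
  by apply/esym/negbTE/imsetP => -[].
apply/eqP/imsetP => [[->]|[k _ [-> _]]//]; by exists j'.
Qed.

Lemma free_two_cliques (q r s c : nat) : 0 < r -> c <= r ->
  Defs.free (star r) (two_cliques q r s c).
Proof.
move=> r_gt0 cr; apply/free_starP => -[p|p]; rewrite card_neighbors_two_cliques.
  by rewrite prednK.
by case: c cr p => [|c] cr [i j] //; case: j.
Qed.

(** The degree sum is q r (r-1) + s c (c-1), twice the claimed number of edges. *)
Lemma card_edges_two_cliques (q r s c : nat) :
  #|edges (two_cliques q r s c)| = q * 'C(r, 2) + s * 'C(c, 2).
Proof.
apply/eqP; rewrite -(@eqn_pmul2l 2) // -sum_card_neighbors; apply/eqP.
rewrite big_sumType /=.
under eq_bigr do rewrite card_neighbors_two_cliques.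
under [X in _ + X]eq_bigr do rewrite card_neighbors_two_cliques.
have bin2E n : 2 * 'C(n, 2) = n * n.-1 by rewrite mulnC (bin_ffact n 2) !ffactnS ffactn0 muln1.
rewrite !sum_nat_const !card_prod !card_ord mulnDr ![2 * (_ * _)]mulnCA !bin2E.
by rewrite !mulnA.
Qed.

Lemma leq_N_two_cliques (H : sgraph) (q r s c : nat) :
  N H (copies q (complete r)) <= N H (two_cliques q r s c).
Proof.
pose g (p : copies q (complete r)) : two_cliques q r s c := inl p.
apply: (leq_N _ _ _ g) => [x y []//|x y].
rewrite /adj /= /copies_adj /cluster_adj /= /complete_adj => /andP[/eqP-> xy].
rewrite eqxx andbT; apply: contraNneq xy => -[->]; exact: eqxx.
Qed.

(** * Existence of maxima and the asymptotic comparison *)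

Lemma is_max_exists (A : set nat) (M : nat) :
  (exists j, A j) -> (forall j, A j -> j <= M) -> exists k, is_max A k.
Proof.
move=> exA leM; pose P j := `[< A j >].
have exP : exists j, P j by case: exA => j Aj; exists j; apply/asboolP.
have leP j : P j -> j <= M by move/asboolP/leM.
case: (ex_maxnP exP leP) => k /asboolP Ak kmax.
by exists k; split=> // j Aj; apply/kmax/asboolP.
Qed.

Local Open Scope classical_set_scope.
Local Open Scope ring_scope.

(** Common analytic core of both statements: [a] stands for the count in K_r, [d] for the vertices
    or edges of K_r, and [c n] for the count in the disjoint copies. The maximum exceeds [c n] by at
    most [a], while [c n] is at least [n %/ d * a], so the relative error is O(1/n). *)
Lemma is_max_asymptotic (R : realType) (A : nat -> set nat) (c : nat -> nat)
    (a d : nat) :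
  (0 < d)%N ->
  (forall n, exists j, A n j /\ (c n <= j)%N) ->
  (forall n j, A n j -> (d * j <= n * a)%N) ->
  (forall n, (n %/ d * a <= c n)%N) ->
  exists eps : nat -> R,
    eps n @[n --> \oo] --> (0 : R) /\
    \forall n \near \oo, exists2 k : nat, is_max (A n) k &
      k%:R = (1 - eps n) * (c n)%:R :> R.
Proof.
move=> d_gt0 exA leA le_c.
(* As [d] is positive, the upper bound makes every element of [A n] at most [n * a], even when the
   graphs behind [A n] have arbitrarily many vertices. *)
have /choice[k kP] n : exists k, is_max (A n) k.
  apply: (is_max_exists _ (n * a)%N); first by have [j []] := exA n; exists j.
  by move=> j /leA; apply: leq_trans; rewrite leq_pmull.
have c_le_k n : (c n <= k n)%N.
  by have [j [Aj cj]] := exA n; apply: leq_trans cj _; apply: (kP n).2.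
have dk n : (d * k n <= n * a)%N := leA _ _ (kP n).1.
have div_gt0 n : (d <= n)%N -> (0 < n %/ d)%N by rewrite divn_gt0.
(* This error term is nonpositive, since the maximum is at least [c n]. If [c n = 0] the quotient is
   0 by convention; for [n >= d] this forces [a = 0], so the maximum vanishes and the identity still
   holds. *)
exists (fun n => ((c n)%:R - (k n)%:R) / (c n)%:R); split; last first.
  near=> n; exists (k n) => //.
  have dn : (d <= n)%N by near: n; exists d.
  have [c0|c_neq0] := eqVneq (c n) 0%N; last first.
    by rewrite mulrBl mul1r divfK ?pnatr_eq0 // opprB addrC subrK.
  have a0 : a = 0%N.
    by have := le_c n; rewrite c0 leqn0 muln_eq0 eqn0Ngt div_gt0 //= => /eqP.
  have := dk n; rewrite a0 muln0 leqn0 muln_eq0 eqn0Ngt d_gt0 /= => /eqP->.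
  by rewrite c0 mulr0.
(* With q = [n %/ d], [k n - c n <= a] and [n.+1 <= q.+1 * d]. Since q is positive, q + 1 <= 2q, and
   [q * a <= c n] gives the constant [2 * d]. *)
have bound n : (d <= n)%N -> ((k n - c n) * n.+1 <= 2 * d * c n)%N.
  move=> dn; have q_gt0 := div_gt0 _ dn; have ltn_q := ltn_ceil n d_gt0.
  have k_sub : (k n - c n <= a)%N.
    rewrite leq_subLR -(leq_pmul2l d_gt0); apply: leq_trans (dk n) _.
    apply: leq_trans (leq_mul (ltnW ltn_q) (leqnn a)) _.
    by rewrite -mulnA mulnCA leq_pmul2l // mulSn addnC leq_add2r.
  apply: leq_trans (leq_mul k_sub ltn_q) _.
  have -> : (a * ((n %/ d).+1 * d) = d * ((n %/ d).+1 * a))%N.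
    by rewrite mulnC -mulnA mulnCA.
  rewrite -mulnA [(2 * _)%N]mulnCA leq_pmul2l // mulSn mul2n -addnn leq_add //.
  by apply: leq_trans (le_c n); rewrite leq_pmull.
have lower_cvg : - ((2 * d)%:R * harmonic n) @[n --> \oo] --> (0 : R).
  by rewrite -[X in _ --> X]oppr0; apply: cvgN; rewrite -(mulr0 (2 * d)%:R); apply: cvgMr; exact: cvg_harmonic.
(* The error lies between -2d/(n+1) and 0; the [n.+1] in [bound] matches the denominator of
   [harmonic]. *)
apply: (squeeze_cvgr _ lower_cvg (cvg_cst 0)).
near=> n; have dn : (d <= n)%N by near: n; exists d.
apply/andP; split; last first.
  by rewrite mulr_le0_ge0 ?invr_ge0 ?ler0n // subr_le0 ler_nat.
have [->|c_neq0] := eqVneq (c n) 0%N.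
  by rewrite invr0 mulr0 oppr_le0 mulr_ge0 ?ler0n // harmonic_ge0.
rewrite lerNl -mulNr opprB -natrB // ler_pdivrMr ?ltr0n ?lt0n //.
rewrite /harmonic mulrAC ler_pdivlMr ?ltr0n // -!natrM ler_nat.
exact: bound.
Unshelve. all: end_near.
Qed.

Theorem theorem5p6 (R : realType) (t : nat) (H : sgraph) (Ht : #|H| = t)
    (r : nat) :
  ((1 <= r)%N -> (1 <= #|dominating H|)%N ->
    exists eps : nat -> R,
      eps n @[n --> \oo] --> (0 : R) /\
      \forall n \near \oo, exists2 k : nat, is_ex n H (star r) k &
        k%:R = (1 - eps n) * (N H (copies (n %/ r) (complete r)))%:R :> R) /\
  ((2 <= r)%N -> (2 <= #|dominating H|)%N ->
    exists eps : nat -> R,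
      eps m @[m --> \oo] --> (0 : R) /\
      \forall m \near \oo, exists2 k : nat, is_mex m H (star r) k &
        k%:R = (1 - eps m) * (N H (copies (m %/ 'C(r, 2)) (complete r)))%:R :> R).
Proof.
split=> [r_gt0 dom_gt0|r_gt1 dom_gt1].
  apply: (is_max_asymptotic R _ _ (N H (complete r)) r r_gt0).
  (* The remainder [n %% r] is filled with isolated vertices, giving exactly [n] vertices. *)
  - move=> n; pose G := two_cliques (n %/ r) r (n %% r) 1.
    exists (N H G); split; last exact: leq_N_two_cliques.
    exists G; split=> //; last exact: free_two_cliques.
    by rewrite card_two_cliques muln1 -divn_eq.
  - by move=> n _ [G [<- G_free <-]]; apply: leq_N_vertices.
  - move=> n; apply: leq_N_copies; exact: leq_trans dom_gt0 (max_card _).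
have bin_gt0 : (0 < 'C(r, 2))%N by rewrite bin_gt0.
apply: (is_max_asymptotic R _ _ (N H (complete r)) _ bin_gt0).
(* The remainder is filled with disjoint single edges, giving exactly [m] edges; star-freeness holds
   because [2 <= r]. *)
- move=> m; pose G := two_cliques (m %/ 'C(r, 2)) r (m %% 'C(r, 2)) 2.
  exists (N H G); split; last exact: leq_N_two_cliques.
  exists G; split=> //; last exact: free_two_cliques (ltnW r_gt1) r_gt1.
  by rewrite card_edges_two_cliques binn muln1 -divn_eq.
- by move=> m _ [G [<- G_free <-]]; apply: leq_N_edges.
- move=> m; apply: leq_N_copies; exact: leq_trans (ltnW dom_gt1) (max_card _).
Qed.
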